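(* Let $\mathbf{C}$ be a dilating-rotating soliton with parameters $\alpha$, $\mathcal{A}$ (and $\mathbf{v}=0$). Then the orthogonal projection of $\mathbf{C}$ onto the null space $N(\mathcal{A})$ of $\mathcal{A}$ is contained in a two dimensional subspace of $N(\mathcal{A})$. In particular, all purely dilating solitons ($\alpha\neq0$, $\mathcal{A}=0$, $\mathbf{v}=0$) are planar: they are copies of the Abresch-Langer curves.
   Context: A soliton with parameters $\alpha\in\mathbb{R}$, $\mathcal{A}$ a real antisymmetric $n\times n$ matrix, and $\mathbf{v}\in\mathbb{R}^n$ is a curve $\mathbf{C}$ in $\mathbb{R}^n$, parametrized by arc length $s$, which satisfies $\mathbf{C}_{ss}=(\alpha+\mathcal{A})\mathbf{C}+\mathbf{v}+\lambda\mathbf{C}_s$, where $\alpha$ stands for $\alpha$ times the identity and $\lambda(s)$ is determined by the condition $\mathbf{C}_s\perp\mathbf{C}_{ss}$. A dilating-rotating soliton is one with $\mathbf{v}=0$. The Abresch-Langer curves are the plane curves, compact or non-compact, that evolve under Curve Shortening by purely shrinking dilation (purely shrinking solitons in the plane).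
   Formalization: Purely dilating solitons are shown to be planar copies of plane solitons with the same α; they are called Abresch-Langer curves only for α<0, since curved expanders (α>0) are not shrinkers. If dim N(A)<2, the subspace is N(A) itself. *)

(* Defs.v *)
From mathcomp Require Import all_boot all_order all_algebra.
From mathcomp Require Import all_classical all_reals all_analysis.
Set Implicit Arguments.
Unset Strict Implicit.
Unset Printing Implicit Defensive.
Import Order.TTheory GRing.Theory Num.Theory.
Import numFieldNormedType.Exports.
Local Open Scope classical_set_scope.
Local Open Scope ring_scope.

(* The library norm on matrices is the sup norm, so the Euclidean structure of
   R^n has to be introduced separately. *)
Definition dotp (R : realType) (n : nat) (u w : 'cV[R]_n) : R :=
  \sum_(i < n) u i 0 * w i 0.

Definition null_space (R : realType) (n : nat) (A : 'M[R]_n) :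
  {vspace 'cV[R]_n} := lker (linfun (mulmx A : 'cV[R]_n -> 'cV[R]_n)).

Definition is_orth_proj (R : realType) (n : nat) (U : {vspace 'cV[R]_n})
    (x p : 'cV[R]_n) : Prop :=
  p \in U /\ (forall u, u \in U -> dotp (x - p) u = 0).

Definition orth_proj (R : realType) (n : nat) (U : {vspace 'cV[R]_n})
    (x : 'cV[R]_n) : 'cV[R]_n := xget 0 [set p | is_orth_proj U x p].

Lemma mem_null_space (R : realType) (n : nat) (A : 'M[R]_n) (x : 'cV[R]_n) :
  (x \in null_space A) = (A *m x == 0).
Proof. by rewrite memv_ker lfunE. Qed.

Lemma dotpE (R : realType) (n : nat) (u w : 'cV[R]_n) :
  dotp u w = (u^T *m w) 0 0.
Proof. by rewrite mxE; apply: eq_bigr => i _; rewrite mxE. Qed.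

Lemma dotp_eq0 (R : realType) (n : nat) (u : 'cV[R]_n) :
  dotp u u = 0 -> u = 0.
Proof.
move=> /eqP; rewrite psumr_eq0 => [/allP h|i _]; last by rewrite -expr2 sqr_ge0.
apply/matrixP => i j; rewrite (ord1 j) mxE; apply/eqP.
by have := h i (mem_index_enum i); rewrite mulf_eq0 orbb.
Qed.

(* The choice made by xget is unique and never falls back on its default. *)
Lemma orth_projP (R : realType) (n : nat) (U : {vspace 'cV[R]_n})
    (x : 'cV[R]_n) : is_orth_proj U x (orth_proj U x).
Proof.
rewrite /orth_proj; case: xgetP => [p -> //|/= none]; exfalso.
pose b := vbasis U.
pose B := \matrix_(i < n, j < \dim U) b`_j i 0.
have BE (y : 'cV[R]_(\dim U)) : B *m y = \sum_j y j 0 *: b`_j.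
  apply/matrixP => i k; rewrite (ord1 k) mxE summxE.
  by apply: eq_bigr => j _; rewrite !mxE mulrC.
have BU y : B *m y \in U.
  rewrite BE; apply: memv_suml => j _; apply: memvZ.
  by apply: vbasis_mem; rewrite mem_nth ?size_tuple.
have Bspan u : u \in U -> exists y, u = B *m y.
  move=> uU; exists (\col_j coord b j u); rewrite BE {1}(coord_vbasis uU).
  by apply: eq_bigr => j _; rewrite mxE.
have Binj (y : 'cV[R]_(\dim U)) : B *m y = 0 -> y = 0.
  rewrite BE => y0; apply/matrixP => j k; rewrite (ord1 k) mxE.
  have /freeP fb := basis_free (vbasisP U).
  exact: (fb (fun j => y j 0) y0).
have Gu : B^T *m B \in unitmx.
  rewrite -row_free_unit -kermx_eq0; apply/eqP/row_matrixP => i.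
  rewrite row0; set r := row i _.
  have r0 : r *m (B^T *m B) = 0.
    by apply/sub_kermxP; exact: row_sub.
  apply: trmx_inj; rewrite trmx0; apply: Binj; apply: dotp_eq0.
  by rewrite dotpE trmx_mul trmxK -mulmxA (mulmxA B^T) mulmxA r0 mul0mx mxE.
have := none (B *m (invmx (B^T *m B) *m (B^T *m x))); apply; split=> // u.
move=> /Bspan[y ->]; rewrite dotpE mulmxA; set d := x - _.
have -> : d^T *m B = (B^T *m d)^T by rewrite trmx_mul trmxK.
rewrite /d mulmxBr (mulmxA B^T B) (mulmxA (B^T *m B)) mulmxV // mul1mx subrr.
by rewrite trmx0 mul0mx mxE.
Qed.

Lemma orth_proj_unique (R : realType) (n : nat) (U : {vspace 'cV[R]_n})
    (x p : 'cV[R]_n) : is_orth_proj U x p -> p = orth_proj U x.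
Proof.
have [qU qx] := orth_projP U x => -[pU px].
have dU : p - orth_proj U x \in U by rewrite memvB.
apply/eqP; rewrite -subr_eq0; apply/eqP/dotp_eq0.
have -> : dotp (p - orth_proj U x) (p - orth_proj U x) =
    dotp (x - orth_proj U x) (p - orth_proj U x) -
    dotp (x - p) (p - orth_proj U x).
  rewrite -sumrB; apply: eq_bigr => i _.
  by rewrite -mulrBl !mxE; congr (_ * _); rewrite [RHS]addrC opprB subrKA.
by rewrite px // qx // subrr.
Qed.

(* A soliton, parametrized by arc length s in an open interval I (possibly the
   whole line); off I the function C is unconstrained. *)
Definition soliton (R : realType) (n : nat) (I : set R) (alpha : R)
    (A : 'M[R]_n) (v : 'cV[R]_n) (C : R -> 'cV[R]_n) : Prop :=
  [/\ open I, is_interval I, A^T = - A &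
    exists lambda : R -> R, forall s, I s ->
      [/\ derivable C s 1, derivable (derive1 C) s 1,
          dotp (derive1 C s) (derive1 C s) = 1,
          dotp (derive1 C s) (derive1 (derive1 C) s) = 0 &
          derive1 (derive1 C) s =
            (alpha%:M + A) *m C s + v + lambda s *: derive1 C s]].

(* The component of alpha * C normal to the curve is its curvature vector, so
   such a curve shrinks under Curve Shortening when alpha < 0 and expands when
   alpha > 0. *)
Definition abresch_langer (R : realType) (I : set R) (c : R -> 'cV[R]_2) :
    Prop :=
  exists2 alpha : R, alpha < 0 & soliton I alpha 0 0 c.

(* C lies in a plane U through the origin, and a linear isometry of U into R^2
   carries C to c.  When n < 2, U is the whole of R^n. *)
Definition planar_copy (R : realType) (n : nat) (I : set R)
    (C : R -> 'cV[R]_n) (c : R -> 'cV[R]_2) : Prop :=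
  exists (U : {vspace 'cV[R]_n}) (Q : 'M[R]_(2, n)),
    [/\ \dim U = minn 2 n,
        forall s, I s -> C s \in U,
        forall u w, u \in U -> w \in U -> dotp (Q *m u) (Q *m w) = dotp u w &
        forall s, I s -> c s = Q *m C s].

(* Main.v *)
Require Import Defs.
From mathcomp Require Import all_boot all_order all_algebra.
From mathcomp Require Import all_classical all_reals all_analysis.
From mathcomp Require Import ring lra.
Import Order.TTheory GRing.Theory Num.Theory.
Import numFieldNormedType.Exports.
Local Open Scope classical_set_scope.
Local Open Scope ring_scope.

(** Write N for the null space of A.  For w in N, the function f = <w, C>
    satisfies the scalar equation f'' = alpha f + lambda f', because
    <w, A C> = - <A w, C> = 0.  Orthogonality of C' and C'', with C' of unit
    length, gives lambda = - <(alpha + A) C, C'>, which is continuous.  Hence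
    Gronwall's inequality applied to f^2 + f'^2 shows that f vanishes on the
    whole interval as soon as f and f' vanish at one point s0
    ([linear_ode2_eq0], [soliton_eq0]).

    Let W0 be spanned by the projections onto N of C(s0) and C'(s0).  The
    component of the projection of C(s) in N orthogonal to W0 is some w in N;
    then <w, C> and <w, C'> vanish at s0, so <w, C> is identically zero, and
    <w, w> = <w, C(s)> gives w = 0.  So the projection of C stays in W0, which
    is enlarged inside N to reach the dimension min(2, dim N)
    ([soliton_null_proj_2dim]).

    When A = 0 the projection is the identity, so C itself lies in a subspace
    W of dimension at most 2.  A 2 x n matrix Q for which Q^T Q is the
    orthogonal projection onto W ([orth_proj_factor]) is isometric on W, and
    since C' also stays in W, the plane curve Q C is again a soliton with the
    same alpha ([soliton_mulmx]). *)

(** * Euclidean inner product *)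

Section Dot.
Context {R : realType} {n : nat}.
Implicit Types u w x : 'cV[R]_n.

Lemma dotpC u w : dotp u w = dotp w u.
Proof. by apply: eq_bigr => i _; rewrite mulrC. Qed.

Lemma dotpDr u w x : dotp u (w + x) = dotp u w + dotp u x.
Proof. by rewrite -big_split; apply: eq_bigr => i _; rewrite mxE mulrDr. Qed.

Lemma dotpZr (a : R) u w : dotp u (a *: w) = a * dotp u w.
Proof. by rewrite big_distrr; apply: eq_bigr => i _; rewrite mxE /= mulrCA. Qed.

Lemma dotpBr u w x : dotp u (w - x) = dotp u w - dotp u x.
Proof. by rewrite -scaleN1r dotpDr dotpZr mulN1r. Qed.

Lemma dotp0r u : dotp u 0 = 0.
Proof. by apply: big1 => i _; rewrite mxE mulr0. Qed.

Lemma dotp0l u : dotp 0 u = 0.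
Proof. by rewrite dotpC dotp0r. Qed.

Lemma trmx_mul_dotp u w : u^T *m w = (dotp u w)%:M.
Proof. by apply/matrixP => i j; rewrite !ord1 -dotpE !mxE mulr1n. Qed.

Lemma dotp_mulmxr m u (M : 'M[R]_(n, m)) (y : 'cV[R]_m) :
  dotp u (M *m y) = dotp (M^T *m u) y.
Proof. by rewrite !dotpE trmx_mul trmxK mulmxA. Qed.

(** The difference between x and its projection onto U is orthogonal to U. *)
Lemma dotp_orth_proj {U : {vspace 'cV[R]_n}} {u} x :
  u \in U -> dotp u (orth_proj U x) = dotp u x.
Proof.
have [_ xU] := orth_projP U x; move=> /xU /eqP.
by rewrite dotpC dotpBr subr_eq0 => /eqP ->.
Qed.
End Dot.

(** * Derivatives of vector-valued functions *)

Lemma is_derive_mxP {R : realType} {m n : nat} {M : R -> 'M[R]_(m, n)}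
    {s : R} {dM : 'M[R]_(m, n)} :
  is_derive s 1 M dM <-> forall i j, is_derive s 1 (fun t => M t i j) (dM i j).
Proof.
split=> [[dM1 dM2] i j|H].
  apply: DeriveDef; first by move/derivable_mxP: dM1; apply.
  by rewrite -dM2 derive_mx // mxE.
have D : derivable M s 1 by apply/derivable_mxP => i j; case: (H i j).
apply: DeriveDef => //; rewrite derive_mx //; apply/matrixP => i j.
by rewrite mxE; case: (H i j).
Qed.

Lemma is_derive_dotp {R : realType} {n : nat} {u w : R -> 'cV[R]_n} {s : R}
    {du dw : 'cV[R]_n} :
  is_derive s 1 u du -> is_derive s 1 w dw ->
  is_derive s 1 (fun t => dotp (u t) (w t)) (dotp du (w s) + dotp (u s) dw).
Proof.
move=> /is_derive_mxP Hu /is_derive_mxP Hw.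
pose h i t := u t i 0 * w t i 0.
have -> : (fun t => dotp (u t) (w t)) = \sum_(i < n) h i.
  by apply/funext => t; rewrite fct_sumE.
have H i : is_derive s 1 (h i) (u s i 0 *: dw i 0 + w s i 0 *: du i 0).
  exact: is_deriveM (Hu i 0) (Hw i 0).
apply: (is_derive_eq (is_derive_sum H)).
rewrite -big_split; apply: eq_bigr => i _ /=.
by rewrite /GRing.scale /= [LHS]addrC mulrC.
Qed.

Lemma is_derive_dotp_cst {R : realType} {n : nat} (w : 'cV[R]_n)
    {u : R -> 'cV[R]_n} {s : R} {du : 'cV[R]_n} :
  is_derive s 1 u du -> is_derive s 1 (fun t => dotp w (u t)) (dotp w du).
Proof.
move=> Hu; apply: (is_derive_eq (is_derive_dotp (is_derive_cst w s 1) Hu)).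
by rewrite dotp0l add0r.
Qed.

Lemma is_derive_mulmx {R : realType} {m n : nat} (M : 'M[R]_(m, n))
    {u : R -> 'cV[R]_n} {s : R} {du : 'cV[R]_n} :
  is_derive s 1 u du -> is_derive s 1 (fun t => M *m u t) (M *m du).
Proof.
move=> Hu; apply/is_derive_mxP => i j; rewrite (ord1 j).
have E (y : 'cV[R]_n) : (M *m y) i 0 = dotp (row i M)^T y.
  by rewrite !mxE; apply: eq_bigr => k _; rewrite !mxE.
under eq_fun do rewrite E.
by rewrite E; exact: is_derive_dotp_cst.
Qed.

Lemma derivable_is_derive1 {R : realType} {V : normedModType R}
    {f : R -> V} {s : R} :
  derivable f s 1 -> is_derive s 1 f (derive1 f s).
Proof. by move=> H; apply: DeriveDef => //; rewrite derive1E. Qed.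

Lemma is_derive1_continuous {R : realType} {f : R -> R} {s d : R} :
  is_derive s 1 f d -> {for s, continuous f}.
Proof. by case=> H _; apply/differentiable_continuous/derivable1_diffP. Qed.

(** * Uniqueness for second-order linear equations *)

Section Gronwall.
Context {R : realType}.
Implicit Types (E dE f df ddf mu : R -> R) (a b K : R).

Lemma is_derive_mul_expR {E dE} (c : R) {s : R} :
  is_derive s 1 E (dE s) ->
  is_derive s 1 (fun t => E t * expR (c * t)) ((dE s + c * E s) * expR (c * s)).
Proof.
move=> HE.
have Hc : is_derive s 1 (fun t => c * t) c.
  apply: (is_derive_eq (is_deriveZ c (is_derive_id s 1))).
  by rewrite /GRing.scale /= mulr1.
apply: (is_derive_eq
  (is_deriveM HE (is_derive1_comp (is_derive_expR (c * s)) Hc))).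
by rewrite /GRing.scale /=; ring.
Qed.

Lemma is_derive_within_continuous {E dE a b} :
  (forall t, a <= t <= b -> is_derive t 1 E (dE t)) ->
  {within `[a, b], continuous E}.
Proof.
move=> HE; apply: continuous_in_subspaceT => t; rewrite inE /= in_itv /= => tab.
exact: is_derive1_continuous (HE _ tab).
Qed.

(** Homogeneous Gronwall inequality, on both sides of the initial point. *)
Lemma gronwall_eq0 {E} dE K {a b} s0 {s} :
  (forall t, a <= t <= b -> is_derive t 1 E (dE t)) ->
  (forall t, a <= t <= b -> 0 <= E t) ->
  (forall t, a <= t <= b -> `|dE t| <= K * E t) ->
  a <= s0 <= b -> a <= s <= b -> E s0 = 0 -> E s = 0.
Proof.
move=> HE E0 EK s0ab sab Es0.
(* With c = -K the function F is nonincreasing, which carries the zero of E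
   forward; with c = K it is nondecreasing, which carries it backward. *)
pose F c t := E t * expR (c * t).
have HF c t : a <= t <= b ->
    is_derive t 1 (F c) ((dE t + c * E t) * expR (c * t)).
  by move=> /HE; exact: is_derive_mul_expR.
have cF c := is_derive_within_continuous (HF c).
have oc t : t \in `]a, b[%R -> a <= t <= b.
  by rewrite in_itv /= => /andP[/ltW -> /ltW ->].
have dF c t : t \in `]a, b[%R -> derivable (F c) t 1.
  by move=> /oc /(HF c)[].
have F'E c t : t \in `]a, b[%R ->
    derive1 (F c) t = (dE t + c * E t) * expR (c * t).
  by move=> /oc /(HF c)[_ <-]; rewrite derive1E.
suff FE c : F c s <= F c s0 -> E s = 0.
  have /andP[as0 s0b] := s0ab; have /andP[as_ sb] := sab.
  have [s0s|/ltW ss0] := leP s0 s.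
    apply: (FE (- K)).
    apply: (ler0_derive1_nincr (dF _) _ (cF _) as0 s0s sb) => t tab.
    rewrite (F'E _ _ tab); apply: mulr_le0_ge0 (expR_ge0 _).
    rewrite mulNr subr_le0.
    by have := EK t (oc t tab); rewrite ler_norml => /andP[].
  apply: (FE K).
  apply: (ger0_derive1_ndecr (dF _) _ (cF _) as_ ss0 s0b) => t tab.
  rewrite (F'E _ _ tab); apply: mulr_ge0 (expR_ge0 _).
  rewrite -lerBlDr sub0r.
  by have := EK t (oc t tab); rewrite ler_norml => /andP[].
rewrite /F Es0 mul0r pmulr_lle0 ?expR_gt0 // => Es.
by apply/eqP; rewrite eq_le Es E0.
Qed.

(** Uniqueness for f'' = alpha f + mu f' with mu continuous on I: mu is bounded
    between s0 and s, so f^2 + f'^2 satisfies a Gronwall inequality there. *)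
Lemma linear_ode2_eq0 {I : set R} {alpha : R} {f} df ddf mu {s0 : R} :
  is_interval I -> I s0 ->
  (forall s, I s -> is_derive s 1 f (df s)) ->
  (forall s, I s -> is_derive s 1 df (ddf s)) ->
  (forall s, I s -> ddf s = alpha * f s + mu s * df s) ->
  (forall s, I s -> {for s, continuous mu}) ->
  f s0 = 0 -> df s0 = 0 -> forall s, I s -> f s = 0.
Proof.
move=> itvI Is0 Hf Hdf ode cmu fs0 dfs0 s Is.
pose a := Num.min s0 s; pose b := Num.max s0 s.
have abI t : a <= t <= b -> I t.
  have [Ia Ib] : I a /\ I b by rewrite /a /b; case: (leP s0 s).
  by move=> H; apply: itvI H.
have s0ab : a <= s0 <= b by rewrite /a /b ge_min le_max lexx.
have sab : a <= s <= b by rewrite /a /b ge_min le_max lexx !orbT.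
have leab : a <= b by case/andP: sab; exact: le_trans.
have [|K0 _ HK] := @EVT_max R (fun t => `|mu t|) a b leab.
  apply: continuous_in_subspaceT => t; rewrite inE /= in_itv /= => /abI /cmu.
  by move=> Hmu; apply: cvg_norm; exact: Hmu.
set K := `|mu K0| in HK.
have muK t : a <= t <= b -> `|mu t| <= K.
  by move=> tab; apply: HK; rewrite in_itv.
pose E t := f t * f t + df t * df t.
suff : E s = 0.
  move=> /eqP; rewrite paddr_eq0 -?expr2 ?sqr_ge0 // sqrf_eq0.
  by case/andP => /eqP.
pose dE t := 2 * f t * df t + 2 * df t * ddf t.
(* E' = 2 (1 + alpha) f f' + 2 mu f'^2, and 2 |f f'| <= E, f'^2 <= E. *)
apply: (@gronwall_eq0 E dE (`|1 + alpha| + 2 * K) a b s0) => //.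
- move=> t /abI It.
  apply: (is_derive_eq (is_deriveD (is_deriveM (Hf _ It) (Hf _ It))
    (is_deriveM (Hdf _ It) (Hdf _ It)))).
  by rewrite /dE /GRing.scale /=; ring.
- by move=> t _; rewrite /E -!expr2 addr_ge0 ?sqr_ge0.
- move=> t tab; rewrite /dE ode; last exact: abI.
  have -> : 2 * f t * df t + 2 * df t * (alpha * f t + mu t * df t)
    = (1 + alpha) * (2 * f t * df t) + 2 * (mu t * df t ^+ 2) by ring.
  apply: (le_trans (ler_normD _ _)).
  rewrite [leRHS]mulrDl lerD //.
    rewrite normrM ler_wpM2l // ler_norml /E -!expr2.
    have := sqr_ge0 (f t - df t); have := sqr_ge0 (f t + df t).
    rewrite sqrrD sqrrB; lra.
  rewrite normrM ger0_norm // normrM normrX real_normK ?num_real //.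
  rewrite -mulrA ler_pM2l // ler_pM ?sqr_ge0 ?muK //.
  by rewrite /E -!expr2 lerDr sqr_ge0.
- by rewrite /E fs0 dfs0 !mul0r addr0.
Qed.
End Gronwall.

(** * Subspaces of R^n *)

Section Dim.
Context {R : realType} {n : nat}.
Implicit Types U V W : {vspace 'cV[R]_n}.

Lemma vspace_between {U V} k :
  (U <= V)%VS -> (\dim U <= k <= \dim V)%N ->
  exists W, [/\ (U <= W)%VS, (W <= V)%VS & \dim W = k].
Proof.
move=> UV /andP[Uk kV]; elim: k Uk kV => [|k IH].
  by rewrite leqn0 => /eqP dU _; exists U; split.
rewrite leq_eqVlt => /orP[/eqP dU _|]; first by exists U; split.
rewrite ltnS => Uk kV; have [W [UW WV dW]] := IH Uk (ltnW kV).
have : ~~ (V <= W)%VS by apply: contraL kV => /dimvS; rewrite dW -leqNgt.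
move=> /subvPn[x xV xW]; exists (W + <[x]>)%VS; split.
- exact: subv_trans UW (addvSl _ _).
- by rewrite subv_add WV -memvE.
rewrite dimv_disjoint_sum ?dW ?dim_vline; last first.
  apply/eqP; rewrite -subv0; apply/subvP => y; rewrite memv_cap memv0.
  move=> /andP[yW /vlineP[c yc]]; move: yW; rewrite yc.
  have [->|c0] := eqVneq c 0; first by rewrite scale0r eqxx.
  by move=> /(memvZ c^-1); rewrite scalerK // (negbTE xW).
by rewrite (_ : x != 0) ?addn1 //; apply: contraNneq xW => ->; rewrite mem0v.
Qed.

(** The orthogonal projection onto U is Q^T Q for some Q with m >= dim U rows:
    the nonzero rows of Q form an orthonormal basis of U, built by splitting off
    one unit vector e of U at each step. *)
Lemma orth_proj_factor {m U} : (\dim U <= m)%N ->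
  exists Q : 'M[R]_(m, n), forall x, is_orth_proj U x (Q^T *m (Q *m x)).
Proof.
elim: m U => [|m IH] U dU; have [->|U0] := eqVneq U 0%VS.
- exists 0 => x; rewrite mul0mx mulmx0; split; first exact: mem0v.
  by move=> u; rewrite memv0 => /eqP ->; exact: dotp0r.
- by move: U0; rewrite -dimv_eq0 -leqn0 dU.
- exists 0 => x; rewrite mul0mx mulmx0; split; first exact: mem0v.
  by move=> u; rewrite memv0 => /eqP ->; exact: dotp0r.
move: U0; rewrite -vpick0 => e0N.
have [e eU ee] : exists2 e, e \in U & dotp e e = 1.
  move: e0N (memv_pick U); set e0 := vpick U => e0N e0U.
  have d0 : 0 < dotp e0 e0.
    rewrite lt_neqAle eq_sym; apply/andP; split.
      by apply: contraNneq e0N => /dotp_eq0 ->.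
    by apply: sumr_ge0 => i _; rewrite -expr2 sqr_ge0.
  exists ((Num.sqrt (dotp e0 e0))^-1 *: e0); first by rewrite memvZ.
  rewrite dotpZr dotpC dotpZr mulrA -invfM -expr2 sqr_sqrtr ?ltW //.
  by rewrite mulVf // gt_eqF.
(* U' is the orthogonal complement of e in U: as e is nonzero, (e e^T) u = 0
   says that <e, u> = 0. *)
pose U' := (U :&: null_space (e *m e^T))%VS.
have memU' u : (u \in U') = (u \in U) && (dotp e u == 0).
  rewrite memv_cap mem_null_space -mulmxA; congr (_ && _).
  rewrite trmx_mul_dotp mul_mx_scalar scaler_eq0 orbC.
  have /negbTE -> // : e != 0.
  apply: contraTneq (oner_neq0 R) => e00.
  by rewrite -ee negbK {1}e00 dotp0l.
have dU' : (\dim U' <= m)%N.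
  rewrite -ltnS; apply: leq_trans dU; rewrite ltn_neqAle dimvS ?capvSl // andbT.
  have := dimv_leqif_eq (capvSl U (null_space (e *m e^T))).
  move=> [_ ->]; apply/negP => /eqP UU'; have := eU.
  by rewrite -UU' memU' ee oner_eq0 andbF.
have [Q HQ] := IH U' dU'.
exists (col_mx e^T Q) => x.
have -> : (col_mx e^T Q)^T *m (col_mx e^T Q *m x)
    = dotp e x *: e + Q^T *m (Q *m x).
  rewrite tr_col_mx trmxK mul_col_mx mul_row_col.
  by rewrite trmx_mul_dotp mul_mx_scalar.
have [pU' HQ2] := HQ x; set p := Q^T *m (Q *m x) in pU' HQ2 *.
move: (pU'); rewrite memU' => /andP[pU /eqP ep].
split; first by rewrite memvD ?memvZ.
move=> u uU; set c := dotp e u.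
have u'U' : u - c *: e \in U'.
  by rewrite memU' memvB ?memvZ //= dotpBr dotpZr ee mulr1 subrr.
move: (HQ2 _ u'U').
rewrite dotpC dotpBr (dotpC _ x) (dotpC _ p) !dotpBr !dotpZr (dotpC p e) ep.
move=> orth.
rewrite (dotpC _ u) dotpBr dotpDr dotpZr.
rewrite (dotpC u x) (dotpC u p) (dotpC u e) -/c (dotpC e x); lra.
Qed.
End Dim.

(** * Solitons with zero translation part *)

Section Soliton.
Context {R : realType}.

(** A vector of the null space that is orthogonal to C and C' at one point is
    orthogonal to C on all of I. *)
Lemma soliton_eq0 {n : nat} {I : set R} {alpha : R} {A : 'M[R]_n}
    {C : R -> 'cV[R]_n} {w : 'cV[R]_n} {s0 : R} :
  soliton I alpha A 0 C -> w \in null_space A -> I s0 ->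
  dotp w (C s0) = 0 -> dotp w (derive1 C s0) = 0 ->
  forall s, I s -> dotp w (C s) = 0.
Proof.
move=> [_ itvI antiA [lam sol]] wN Is0 wC0 wdC0.
have HC s : I s -> is_derive s 1 C (derive1 C s).
  by move=> /sol[? _ _ _ _]; exact: derivable_is_derive1.
have HdC s : I s -> is_derive s 1 (derive1 C) (derive1 (derive1 C) s).
  by move=> /sol[_ ? _ _ _]; exact: derivable_is_derive1.
(* lambda, which is given without any regularity, coincides on I with mu. *)
pose mu t := dotp ((- (alpha%:M + A)) *m C t) (derive1 C t).
apply: (linear_ode2_eq0 (fun t => dotp w (derive1 C t))
  (fun t => dotp w (derive1 (derive1 C) t)) mu itvI Is0) => //.
- by move=> s Is; apply: is_derive_dotp_cst; exact: HC.
- by move=> s Is; apply: is_derive_dotp_cst; exact: HdC.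
- move=> s Is; have [_ _ nC1 orthC eqC] := sol s Is.
  have -> : mu s = lam s.
    move: orthC; rewrite eqC addr0 dotpDr dotpZr nC1 mulr1 /mu mulNmx.
    rewrite (dotpC (- _)) -scaleN1r dotpZr mulN1r.
    by move=> /eqP; rewrite addrC addr_eq0 => /eqP.
  rewrite eqC addr0 mulmxDl mul_scalar_mx !dotpDr !dotpZr.
  rewrite dotp_mulmxr antiA mulNmx.
  have /eqP -> : A *m w == 0 by rewrite -mem_null_space.
  by rewrite oppr0 dotp0l addr0.
- move=> s Is; apply: is_derive1_continuous.
  exact: is_derive_dotp (is_derive_mulmx _ (HC _ Is)) (HdC _ Is).
Qed.

Lemma soliton_null_proj_2dim {n : nat} {I : set R} {alpha : R} {A : 'M[R]_n}
    {C : R -> 'cV[R]_n} :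
  soliton I alpha A 0 C ->
  exists W : {vspace 'cV[R]_n},
    [/\ (W <= null_space A)%VS,
        \dim W = minn 2 (\dim (null_space A)) &
        forall s, I s -> orth_proj (null_space A) (C s) \in W].
Proof.
move=> sol; set N := null_space A.
have [[s0 Is0]|noI] := pselect (exists s, I s); last first.
  have [|W [_ WN dW]] := vspace_between (minn 2 (\dim N)) (sub0v N).
    by rewrite dimv0 geq_minr.
  by exists W; split=> // s Is; case: noI; exists s.
(* W0 may have dimension less than 2 and is enlarged inside N. *)
pose p := orth_proj N (C s0); pose q := orth_proj N (derive1 C s0).
pose W0 := (<[p]> + <[q]>)%VS.
have projN x : orth_proj N x \in N by case: (orth_projP N x).
have W0N : (W0 <= N)%VS by rewrite subv_add -!memvE !projN.
have [|W [W0W WN dW]] := vspace_between (minn 2 (\dim N)) W0N.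
  rewrite geq_minr leq_min dimvS // !andbT.
  apply: leq_trans (dimv_add_leqif _ _) _; rewrite !dim_vline.
  by case: (p != 0); case: (q != 0).
exists W; split=> // s Is; apply: (subvP W0W).
set x := orth_proj N (C s); have [rW0 orth] := orth_projP W0 x.
set r := orth_proj W0 x in rW0 orth.
have dN : x - r \in N by rewrite memvB ?projN ?(subvP W0N).
have dC : dotp (x - r) (C s) = 0.
  apply: (soliton_eq0 sol dN Is0) => //;
    rewrite -(dotp_orth_proj _ dN); apply: orth.
  - by rewrite (subvP (addvSl _ _)) ?memv_line.
  - by rewrite (subvP (addvSr _ _)) ?memv_line.
suff /eqP : x - r = 0 by rewrite subr_eq0 => /eqP ->.
by apply: dotp_eq0; rewrite dotpBr (orth _ rW0) subr0 (dotp_orth_proj _ dN).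
Qed.

(** If C takes its values in a subspace on which Q^T Q is the identity, then Q
    maps C to a soliton with the same alpha; lambda is also unchanged. *)
Lemma soliton_mulmx {m n : nat} {I : set R} {alpha : R} {C : R -> 'cV[R]_n}
    {Q : 'M[R]_(m, n)} :
  (forall s, I s -> Q^T *m (Q *m C s) = C s) ->
  soliton I alpha 0 0 C -> soliton I alpha 0 0 (fun s => Q *m C s).
Proof.
move=> QC [oI itvI _ [lam sol]]; split=> //; first by rewrite trmx0 oppr0.
pose c s := Q *m C s.
have HC s : I s -> is_derive s 1 C (derive1 C s).
  by move=> /sol[? _ _ _ _]; exact: derivable_is_derive1.
have HdC s : I s -> is_derive s 1 (derive1 C) (derive1 (derive1 C) s).
  by move=> /sol[_ ? _ _ _]; exact: derivable_is_derive1.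
have d1 s : I s -> is_derive s 1 c (Q *m derive1 C s).
  by move=> /HC; exact: is_derive_mulmx.
have d1E s : I s -> derive1 c s = Q *m derive1 C s.
  by move=> /d1[_ <-]; rewrite derive1E.
have nearI s : I s -> \forall t \near s, I t.
  by move=> Is; exact: open_nbhs_nbhs.
have d2 s : I s -> is_derive s 1 (derive1 c) (Q *m derive1 (derive1 C) s).
  move=> Is; apply: near_eq_is_derive (is_derive_mulmx Q (HdC s Is)).
  by near=> t; rewrite d1E //; near: t; exact: nearI.
(* Differentiate Q^T Q C = C: the hypothesis passes to C'. *)
have QdC s : I s -> Q^T *m (Q *m derive1 C s) = derive1 C s.
  move=> Is.
  have : is_derive s 1 C (Q^T *m (Q *m derive1 C s)).
    apply: near_eq_is_derive (is_derive_mulmx Q^T (d1 s Is)).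
    by near=> t; rewrite /c QC //; near: t; exact: nearI.
  by case=> _ <-; rewrite derive1E.
exists lam => s Is; have [_ _ nC1 orthC eqC] := sol s Is.
have d2E : derive1 (derive1 c) s = Q *m derive1 (derive1 C) s.
  by have [_ <-] := d2 s Is; rewrite derive1E.
rewrite -/c d2E d1E //; split.
- by have [] := d1 s Is.
- by have [] := d2 s Is.
- by rewrite dotp_mulmxr QdC.
- by rewrite dotp_mulmxr QdC.
- rewrite eqC !addr0 mulmxDr -scalemxAr; congr (_ + _).
  by rewrite !mul_scalar_mx -scalemxAr.
Unshelve. all: by end_near.
Qed.
End Soliton.

Theorem lemma5p1 (R : realType) :
  (forall (n : nat) (I : set R) (alpha : R) (A : 'M[R]_n) (C : R -> 'cV[R]_n),
     soliton I alpha A 0 C ->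
     exists W : {vspace 'cV[R]_n},
       [/\ (W <= null_space A)%VS,
           \dim W = minn 2 (\dim (null_space A)) &
           forall s, I s -> orth_proj (null_space A) (C s) \in W]) /\
  (forall (n : nat) (I : set R) (alpha : R) (C : R -> 'cV[R]_n),
     alpha != 0 -> soliton I alpha 0 0 C ->
     exists c : R -> 'cV[R]_2,
       [/\ planar_copy I C c,
           soliton I alpha 0 0 c &
           alpha < 0 -> abresch_langer I c]).
Proof.
split=> [n I alpha A C|n I alpha C _ sol]; first exact: soliton_null_proj_2dim.
have [W [_ dW CW]] := soliton_null_proj_2dim sol.
have null0 : null_space 0 = fullv :> {vspace 'cV[R]_n}.
  by apply/vspaceP => x; rewrite mem_null_space mul0mx eqxx memvf.
rewrite null0 in dW CW.
have projT x : orth_proj fullv x = x :> 'cV[R]_n.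
  apply/esym/orth_proj_unique; split=> [|u _]; first exact: memvf.
  by rewrite subrr dotp0l.
have [|Q HQ] := @orth_proj_factor R n 2 W; first by rewrite dW geq_minl.
have QW u : u \in W -> Q^T *m (Q *m u) = u.
  move=> uW; rewrite (orth_proj_unique (HQ u)); apply/esym/orth_proj_unique.
  by split=> // v _; rewrite subrr dotp0l.
have CsW s : I s -> C s \in W by move=> /CW; rewrite projT.
have solc : soliton I alpha 0 0 (fun s => Q *m C s).
  by apply: soliton_mulmx sol => s /CsW /QW.
exists (fun s => Q *m C s); split=> //; last by exists alpha.
exists W, Q; split=> //.
- by rewrite dW dimvf /dim /= muln1.
- by move=> u w uW _; rewrite dotp_mulmxr QW.
Qed.
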